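(* Let $n\geq 5$ and $3\leq\Delta\leq n-2$ be integers, and let $U$ be a connected unicyclic graph with $n$ vertices and maximum degree $\Delta$. (i) If $3\leq\Delta\leq\lfloor\frac{n+1}{2}\rfloor$, then $$SO(U)\geq \Delta\sqrt{\Delta^2+4}+\sqrt{8}\,(n-2\Delta+2)+\sqrt{5}\,(\Delta-2),$$ with equality if and only if $U$ is isomorphic to a graph $U_\Delta$, i.e. a graph consisting of a cycle $C$ (of any length at least $3$) together with $\Delta-2$ paths, each with at least $2$ edges, each having one endpoint at the same vertex $v_0$ of $C$, and these paths pairwise sharing no vertex other than $v_0$ and sharing no vertex with $C$ other than $v_0$. (ii) If $\lfloor\frac{n+1}{2}\rfloor<\Delta\leq n-2$, then $$SO(U)\geq (n-\Delta+1)\sqrt{\Delta^2+4}+(2\Delta-n-1)\sqrt{\Delta^2+1}+\sqrt{5}\,(n-\Delta-1)+\sqrt{8},$$ with equality if and only if $U\cong U_{n,\Delta}$, where $U_{n,\Delta}$ is the graph obtained from a triangle $C_3$ by attaching, at one vertex $v_0$ of the triangle, $2\Delta-n-1$ pendant edges and $n-\Delta-1$ pendant paths with $2$ edges each.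
   Context: All graphs are finite, simple and undirected; $d_G(v)$ denotes the degree of a vertex $v$ in $G$. A unicyclic graph is a connected graph with exactly one cycle (equivalently, $|E|=|V|$). The Sombor index of a graph $G$ is $SO(G)=\sum_{uv\in E(G)}\sqrt{d_G(u)^2+d_G(v)^2}$. *)

(* Defs.v *)
From HB Require Import structures.
From mathcomp Require Import all_boot all_order all_algebra.
From mathcomp Require Import reals.
Set Implicit Arguments. Unset Strict Implicit. Unset Printing Implicit Defensive.
Import Order.TTheory GRing.Theory Num.Theory.

Section Graphs.
Variable T : finType.
Variable e : rel T.

Definition simple_graph := symmetric e /\ irreflexive e.

Definition deg (v : T) : nat := #|[set w | e v w]|.

Definition maxdeg : nat := (\max_(v : T) deg v)%N.

Definition edges : {set {set T}} := [set [set p.1; p.2] | p : T * T & e p.1 p.2].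

Definition connected := forall x y : T, connect e x y.

Definition unicyclic := connected /\ #|edges| = #|T|.

Definition sombor (R : realType) : R :=
  \sum_(E in edges) Num.sqrt (\sum_(v in E) (deg v)%:R ^+ 2).

(* The graph (on vertex set T) is exactly: a cycle c (vertices listed in
   cyclic order, v0 = head c) together with paths v0 :: p for p in ps,
   all vertices pairwise distinct except the shared v0, covering all of T,
   and no other edges. *)
Definition cycle_with_paths (c : seq T) (ps : seq (seq T)) : Prop :=
  exists v0, exists c', c = v0 :: c' /\
  uniq (c ++ flatten ps) /\ (forall x : T, x \in c ++ flatten ps) /\
  edges = [set [set p.1; p.2] | p : T * T &
             p \in zip c (rot 1 c) ++ flatten [seq zip (v0 :: q) q | q <- ps]].

Definition is_U_Delta (Delta : nat) : Prop :=
  exists c ps, (3 <= size c)%N /\ size ps = (Delta - 2)%N /\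
    all (fun q => 2 <= size q)%N ps /\ cycle_with_paths c ps.

Definition is_U_n_Delta (n Delta : nat) : Prop :=
  exists c ps, size c = 3%N /\
    all (fun q => (size q == 1) || (size q == 2))%N ps /\
    count (fun q => size q == 1)%N ps = (2 * Delta - n - 1)%N /\
    count (fun q => size q == 2)%N ps = (n - Delta - 1)%N /\
    cycle_with_paths c ps.

End Graphs.

(* Main.v *)
Require Import Defs.
From HB Require Import structures.
From mathcomp Require Import all_boot all_order all_algebra.
From mathcomp Require Import reals.
From mathcomp Require Import ring lra zify.
Import Order.TTheory GRing.Theory Num.Theory.
Local Open Scope ring_scope.
Set Implicit Arguments. Unset Strict Implicit. Unset Printing Implicit Defensive.

(** Let f(a,b) = √(a²+b²), and let v0 be a vertex of degree D = Delta.  The degrees sum to 2n.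

    (i) Discharging.  An edge xy avoiding v0 pays h(d(x)) to x and h(d(y)) to y, where
    h(1) = √5-√2, h(2) = √2 and h(d) = 3√2-√5 for d >= 3; an edge v0 w pays f(D,2)-√2 to v0
    and min(h(d(w)), √2) to w.  No edge pays more than its weight, and every w other than v0
    receives at least 2√2 + (3√2-√5)(d(w)-2), which is affine in d(w), so that the degree sum
    gives the bound.  Equality forces d(w) <= 2 off v0 and d(w) = 2 on the neighbours of v0.

    (ii) Take breadth-first parents p(w) towards v0.  The n edges are the n-1 edges w p(w)
    and one further edge, whose ends have degree at least 2 and whose weight is thus at least
    √8.  With t = f(D,2)-f(D,1) in (0,1/2), an edge w p(w) weighs at least f(D,1)+t(d(w)-1)
    when w is adjacent to v0 and at least √5+t(d(w)-1) otherwise; again the degree sum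
    concludes.  Equality forces d(w) <= 2 off v0 and d(w) = 1 off v0 and its neighbours.

    When all degrees off v0 are at most 2, the tree of parents is a bundle of paths issued
    from v0, and the further edge joins the ends of two of them into the cycle. *)

(** * Numerical estimates for edge weights and for the charges *)

Section EdgeWeights.
Variable R : realType.

Definition weight (a b : nat) : R := Num.sqrt (a%:R ^+ 2 + b%:R ^+ 2).

Lemma weightC a b : weight a b = weight b a.
Proof. by rewrite /weight addrC. Qed.

Lemma weight_ge0 a b : 0 <= weight a b.
Proof. exact: sqrtr_ge0. Qed.

Lemma sqr_weight a b : weight a b ^+ 2 = a%:R ^+ 2 + b%:R ^+ 2.
Proof. by rewrite sqr_sqrtr // addr_ge0 ?sqr_ge0. Qed.

Lemma le_weight a b a' b' : (a <= a')%N -> (b <= b')%N ->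
  weight a b <= weight a' b'.
Proof.
by move=> aa bb; apply: ler_wsqrtr; apply: lerD; rewrite lerXn2r ?nnegrE ?ler_nat.
Qed.

Lemma weight_ge (r : R) a b : r ^+ 2 <= a%:R ^+ 2 + b%:R ^+ 2 -> r <= weight a b.
Proof.
by move=> H; apply: le_trans (ler_norm r) _; rewrite -sqrtr_sqr ler_wsqrtr.
Qed.

Lemma weight_gt (r : R) a b : 0 <= r ->
  r ^+ 2 < a%:R ^+ 2 + b%:R ^+ 2 -> r < weight a b.
Proof.
move=> r0 H; rewrite -[r](ger0_norm r0) -sqrtr_sqr ltr_sqrt //.
by apply: le_lt_trans H; rewrite sqr_ge0.
Qed.


Lemma sqrt2_bounds : 141/100 < (Num.sqrt 2 : R) < 142/100.
Proof.
have h : Num.sqrt 2 ^+ 2 = 2 :> R by rewrite sqr_sqrtr.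
have := sqrtr_ge0 (2 : R); move: (Num.sqrt _) h => x h x0; nra.
Qed.

Lemma sqrt5_bounds : 223/100 < (Num.sqrt 5 : R) < 224/100.
Proof.
have h : Num.sqrt 5 ^+ 2 = 5 :> R by rewrite sqr_sqrtr.
have := sqrtr_ge0 (5 : R); move: (Num.sqrt _) h => x h x0; nra.
Qed.

Lemma sqrt8 : Num.sqrt 8 = 2 * Num.sqrt 2 :> R.
Proof.
have -> : 8 = 2 ^+ 2 * 2 :> R by ring.
by rewrite sqrtrM ?sqr_ge0 // sqrtr_sqr ger0_norm.
Qed.

Lemma weight22 : weight 2 2 = 2 * Num.sqrt 2.
Proof. by rewrite -sqrt8 /weight; congr Num.sqrt; ring. Qed.

Lemma weight12 : weight 1 2 = Num.sqrt 5.
Proof. by rewrite /weight; congr Num.sqrt; ring. Qed.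

Lemma weight_ge2 a b : (1 < a)%N -> (1 < b)%N ->
  Num.sqrt 8 <= weight a b ?= iff ((a == 2) && (b == 2))%N.
Proof.
move=> a2 b2; rewrite sqrt8 -weight22; split; first exact: le_weight.
apply/eqP/andP => [E|[/eqP-> /eqP->]//].
have : weight 2 2 ^+ 2 = weight a b ^+ 2 by rewrite E.
rewrite !sqr_weight -!natrX -!natrD => /eqP; rewrite eqr_nat => /eqP {}E.
by split; apply/eqP; nia.
Qed.

(** The squares differ by 3, while the two weights are at least √10 and √13 and so sum to more than
    6. *)
Lemma weight_step (D : nat) : (3 <= D)%N ->
  0 < weight D 2 - weight D 1 < 1/2.
Proof.
move=> D3.
have h1 := sqr_weight D 1; have h2 := sqr_weight D 2.
have g1 : 31/10 <= weight D 1.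
  by apply: le_trans (le_weight D3 (leqnn 1)); apply: weight_ge; lra.
have g2 : 36/10 <= weight D 2.
  by apply: le_trans (le_weight D3 (leqnn 2)); apply: weight_ge; lra.
by nra.
Qed.

(** The left side is the line through the values at d = 1 and d = 2 of a strictly convex function of
    d. *)
Lemma weight_convex (D d : nat) : (3 <= D)%N -> (0 < d)%N ->
  weight D 1 + (weight D 2 - weight D 1) * (d%:R - 1) <= weight D d
    ?= iff (d <= 2)%N.
Proof.
move=> D3; case: d => [//|[|[|d]]] _.
- by rewrite subrr mulr0 addr0; apply/leif_refl.
- by rewrite (_ : 2%:R - 1 = 1 :> R) ?mulr1 ?subrKC; [apply/leif_refl|ring].
have /andP[d0 d1] := weight_step D3.
have h1 := sqr_weight D 1; have h2 := sqr_weight D 2.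
have g1 := weight_ge0 D 1; have g2 := weight_ge0 D 2.
suff H : weight D 1 + (weight D 2 - weight D 1) * (d.+3%:R - 1) < weight D d.+3.
  by split; [exact: ltW|exact: lt_eqF].
have d_ge0 : 0 <= d%:R :> R by [].
have -> : d.+3%:R = d%:R + 3 :> R by rewrite -addn3 natrD.
apply: weight_gt; first by nra.
rewrite (_ : d.+3%:R = d%:R + 3 :> R); last by rewrite -addn3 natrD.
(* The degree is now d + 3. Since 2ut = 3 - t², the difference of the squares factors as (1 - t²)(d
   + 1)(d + 2). *)
set u := weight D 1 in h1 g1 d0 d1 *; set v := weight D 2 in h2 g2 d0 d1 *.
have -> : D%:R ^+ 2 = u ^+ 2 - 1 :> R by rewrite h1; ring.
have E : v ^+ 2 - u ^+ 2 = 3 by rewrite h1 h2; ring.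
set t := v - u in d0 d1 *.
have vE : v = u + t by rewrite /t; ring.
have {}E : 2 * u * t = 3 - t ^+ 2 by rewrite -E vE; ring.
have -> : (u + t * (d%:R + 3 - 1)) ^+ 2
    = u ^+ 2 + (2 * u * t) * (d%:R + 2) + t ^+ 2 * (d%:R + 2) ^+ 2 by ring.
have t2 : t ^+ 2 < 1 by nra.
rewrite E -subr_gt0; set x := (X in 0 < X).
have -> : x = (1 - t ^+ 2) * ((d%:R + 1) * (d%:R + 2)) by rewrite /x; ring.
by rewrite mulr_gt0 ?subr_gt0 //; nra.
Qed.

(** At d = 1 any d' above 2 gives at least √10 > √5; at d = 2 the gap 2√2 - √5 exceeds 1/2; for
    larger d a linear lower bound of slope 12/13 beats the slope t < 1/2. *)
Lemma weight_far (t : R) (d d' : nat) : 0 < t < 1/2 -> (0 < d)%N -> (1 < d')%N ->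
  Num.sqrt 5 + t * (d%:R - 1) <= weight d d' ?= iff ((d == 1) && (d' == 2))%N.
Proof.
move=> /andP[t0 t1] d_gt0 d'_gt1.
have /andP[b1 b2] := sqrt5_bounds; have /andP[a1 a2] := sqrt2_bounds.
have strict : Num.sqrt 5 + t * (d%:R - 1) < weight d d' ->
    Num.sqrt 5 + t * (d%:R - 1) <= weight d d' ?= iff false.
  by move=> H; split; [exact: ltW|exact: lt_eqF].
case: d d_gt0 strict => [//|[|[|d]]] _ strict.
- case: d' d'_gt1 strict => [//|[//|[|d']]] _ strict /=.
    by rewrite subrr mulr0 addr0 weight12; apply/leif_refl.
  apply: strict; apply: lt_le_trans (le_weight (leqnn 1) (_ : 3 <= _)%N) => //.
  by apply: (@lt_le_trans _ _ 3); [lra|apply: weight_ge; lra].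
- apply: strict; apply: lt_le_trans (le_weight (leqnn 2) d'_gt1).
  by rewrite weight22; lra.
apply: strict; apply: lt_le_trans (le_weight (leqnn _) d'_gt1).
have d_ge0 : 0 <= d%:R :> R by [].
have E : d.+3%:R = d%:R + 3 :> R by rewrite -addn3 natrD.
(* Cauchy-Schwarz against the vector (12, 5) of length 13 *)
apply: (@lt_le_trans _ _ ((12 * d.+3%:R + 10) / 13)).
  by rewrite E; nra.
apply: weight_ge; rewrite E; have := sqr_ge0 (5 * (d%:R + 3) - 24 : R); nra.
Qed.

(* A vertex of degree d asks [charge d] from each of its edges.  The values at 1 and 2
   are forced by equality on edges of type (1,2) and (2,2); the value for d >= 3 is the slope
   of [d * charge d] between d = 1 and d = 2. *)
Definition charge (d : nat) : R :=
  if d == 1%N then Num.sqrt 5 - Num.sqrt 2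
  else if d == 2%N then Num.sqrt 2 else 3 * Num.sqrt 2 - Num.sqrt 5.

(* A vertex of degree at least 3 adjacent to v0 asks only √2 from that edge. *)
Definition rebate (d : nat) : R :=
  if (d <= 2)%N then 0 else 2 * Num.sqrt 2 - Num.sqrt 5.

(** The pair (1, 1) is excluded because 2(√5 - √2) > √2. If the larger degree is at least 3,
    monotonicity reduces the claim to the weights √10, √13 and √18. *)
Lemma charge_edge (a b : nat) : (0 < a)%N -> (0 < b)%N -> (2 < a + b)%N ->
  charge a + charge b <= weight a b ?= iff ((a <= 2) && (b <= 2))%N.
Proof.
have /andP[b1 b2] := sqrt5_bounds; have /andP[a1 a2] := sqrt2_bounds.
wlog ab : a b / (a <= b)%N => [H a0 b0 abs|a0 b0 abs].
  case: (leqP a b) => [/H|/ltnW/H]; first exact.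
  by rewrite addrC weightC andbC addnC; apply.
have strict x y : x < y -> x <= y ?= iff false :> R.
  by move=> H; split; [exact: ltW|exact: lt_eqF].
case: (ltnP 2 b) => [b3|b2']; rewrite ?andbF ?andbT.
  have cb : charge b = 3 * Num.sqrt 2 - Num.sqrt 5.
    by rewrite /charge; case: b b3 {ab b0 abs} => [|[|[]]].
  apply: strict; rewrite cb.
  case: a a0 ab abs => [//|[|[|a]]] _ ab _.
  - apply: lt_le_trans (le_weight (leqnn 1) b3).
    by rewrite /charge /=; apply: (@lt_le_trans _ _ 3); [lra|apply: weight_ge; lra].
  - apply: lt_le_trans (le_weight (leqnn 2) b3).
    by rewrite /charge /=; apply: (@lt_le_trans _ _ (36/10)); [lra|apply: weight_ge; lra].
  apply: lt_le_trans (le_weight (_ : 3 <= _)%N b3) => //.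
  by rewrite /charge /=; apply: (@lt_le_trans _ _ (42/10)); [lra|apply: weight_ge; lra].
have -> : (a <= 2)%N by lia.
have bE : b = 2%N by lia.
subst b.
have [->|->] : (a = 1 \/ a = 2)%N by lia.
  by rewrite weight12 /charge /= subrK; apply/leif_refl.
by rewrite weight22 /charge /= -mulr2n mulr_natl; apply/leif_refl.
Qed.

(** For d = 1 this says f(D,2) - f(D,1) < 2√2 - √5, and the left side is below 1/2. For d at least 3
    the rebate lowers the request to √2, and f(D,2) < f(D,d) remains. *)
Lemma charge_center (D d : nat) : (3 <= D)%N -> (0 < d)%N ->
  (weight D 2 - Num.sqrt 2) + (charge d - rebate d) <= weight D d
    ?= iff (d == 2)%N.
Proof.
move=> D3; have /andP[b1 b2] := sqrt5_bounds; have /andP[a1 a2] := sqrt2_bounds.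
have /andP[d0 d1] := weight_step D3.
have strict x y : x < y -> x <= y ?= iff false :> R.
  by move=> H; split; [exact: ltW|exact: lt_eqF].
case: d => [//|[|[|d]]] _; rewrite /charge /rebate /=.
- by apply: strict; lra.
- by rewrite subr0 subrK; apply/leif_refl.
apply: strict; apply: (@le_lt_trans _ _ (weight D 2)); first by lra.
apply: weight_gt; first exact: weight_ge0.
by rewrite sqr_weight ltrD2l ltr_pXn2r ?nnegrE ?ltr_nat.
Qed.

(** Here [b] tells whether the vertex is adjacent to v0. For d at least 3 the gap is (2 - b)(2√2 -
    √5) > 0. *)
Lemma charge_vertex (b : bool) (d : nat) : (0 < d)%N ->
  2 * Num.sqrt 2 + (3 * Num.sqrt 2 - Num.sqrt 5) * (d%:R - 2)
    <= d%:R * charge d - b%:R * rebate d ?= iff (d <= 2)%N.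
Proof.
have /andP[b1 b2] := sqrt5_bounds; have /andP[a1 a2] := sqrt2_bounds.
case: d => [//|[|[|d]]] _; rewrite /charge /rebate /=.
- by apply/leifP/eqP; ring.
- by apply/leifP/eqP; ring.
apply/leifP => /=; case: b => /=; lra.
Qed.

End EdgeWeights.

(** * Double counting in a simple graph, and breadth-first parents *)

Section SimpleGraph.
Variables (T : finType) (e : rel T).
Hypothesis e_simple : simple_graph e.

Let e_sym x y : e x y = e y x. Proof. by case: e_simple => s _; rewrite s. Qed.

Lemma edge_neq x y : e x y -> x != y.
Proof. by case: e_simple => _ irr; case: eqP => // ->; rewrite irr. Qed.

Lemma set2_inj (x y a b : T) :
  [set x; y] = [set a; b] -> (x = a /\ y = b) \/ (x = b /\ y = a).
Proof.
move=> E.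
have := set21 x y; have := set22 x y; rewrite E !inE => Hy Hx.
have := set21 a b; have := set22 a b; rewrite -E !inE => Hb Ha.
case/orP: Hx => /eqP xE; [left|right]; split=> //; subst x.
  by case/orP: Hy Hb => /eqP ->//; rewrite orbb => /eqP.
by case/orP: Hy Ha => /eqP ->//; rewrite orbb => /eqP.
Qed.

Lemma mem_edges x y : ([set x; y] \in edges e) = e x y.
Proof.
apply/imsetP/idP => [[[a b]]|exy]; last by exists (x, y); rewrite ?inE.
by rewrite inE /= => eab /set2_inj [[-> ->]|[-> ->]] //; rewrite e_sym.
Qed.

Lemma edgesP E :
  reflect (exists x y, e x y /\ E = [set x; y]) (E \in edges e).
Proof.
apply: (iffP imsetP) => [[[a b]]|[x [y [exy ->]]]].
  by rewrite inE /= => eab ->; exists a, b.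
by exists (x, y); rewrite ?inE.
Qed.

(** Each edge is met once from each end; irreflexivity makes the two ordered pairs distinct. *)
Lemma sum_arcs (M : nmodType) (F : {set T} -> M) :
  \sum_x \sum_(y | e x y) F [set x; y] = (\sum_(E in edges e) F E) *+ 2.
Proof.
rewrite pair_big_dep /=.
rewrite (partition_big (fun p : T * T => [set p.1; p.2]) (mem (edges e))) /=;
  last by move=> p; rewrite mem_edges.
rewrite -sumrMnl; apply: eq_bigr => E /edgesP[x [y [exy ->]]].
rewrite (bigD1 (x, y)) /= ?exy ?eqxx // (bigD1 (y, x)) /=.
  rewrite [[set y; x]]setUC big1 ?addr0 ?mulr2n // => -[a b] /= /andP[/andP[/andP[_ /eqP]]].
  by case/set2_inj => -[-> ->]; rewrite eqxx.
rewrite e_sym exy setUC eqxx /= xpair_eqE eq_sym.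
by rewrite (negbTE (edge_neq exy)).
Qed.

Lemma sum_neighbors_const (R : realType) x (a : R) :
  \sum_(y | e x y) a = (deg e x)%:R * a.
Proof. by rewrite sumr_const mulr_natl /deg cardsE. Qed.

Lemma handshake (R : realType) : \sum_x (deg e x)%:R = 2 * #|edges e|%:R :> R.
Proof.
rewrite mulr_natl -sumr_const -(@sum_arcs R (fun=> 1)).
by apply: eq_bigr => x _; rewrite sum_neighbors_const mulr1.
Qed.

Lemma sqrt_sum_edge (R : realType) x y : e x y ->
  Num.sqrt (\sum_(v in [set x; y]) (deg e v)%:R ^+ 2) = weight R (deg e x) (deg e y).
Proof. by move=> exy; rewrite big_setU1 ?big_set1 // inE edge_neq. Qed.

Lemma sombor_arcs (R : realType) :
  \sum_x \sum_(y | e x y) weight R (deg e x) (deg e y) = sombor e R *+ 2.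
Proof.
rewrite -(@sum_arcs R (fun E => Num.sqrt (\sum_(v in E) (deg e v)%:R ^+ 2))).
by apply: eq_bigr => x _; apply: eq_bigr => y exy; rewrite sqrt_sum_edge.
Qed.

Lemma deg_gt0 x y : e x y -> (0 < deg e x)%N.
Proof. by move=> exy; apply/card_gt0P; exists y; rewrite inE. Qed.

Lemma deg_ge2 x y z : e x y -> e x z -> y != z -> (2 <= deg e x)%N.
Proof.
move=> exy exz yz; have <- : #|[set y; z]| = 2%N by rewrite cards2 yz.
by apply/subset_leq_card/subsetP => t; rewrite !inE => /orP[] /eqP->.
Qed.

Lemma deg_le2P x y z t : e x y -> e x z -> e x t -> uniq [:: y; z; t] ->
  (deg e x <= 2)%N = false.
Proof.
move=> exy exz ext U; apply/negbTE; rewrite -ltnNge.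
have <- : #|[set u in [:: y; z; t]]| = 3%N by rewrite cardsE (card_uniqP U).
by apply/subset_leq_card/subsetP => s; rewrite !inE => /or3P[] /eqP->.
Qed.

(** [dist] is the least length of a walk from v0. The parent of w is v0 if w is adjacent to v0, and
    otherwise the penultimate vertex of a shortest walk to w. *)
Lemma bfs_parent v0 : connected e -> exists (p : T -> T) (dist : T -> nat),
  [/\ forall w, w != v0 -> e w (p w),
      forall w, w != v0 -> (dist (p w) < dist w)%N
    & forall w, e v0 w -> p w = v0].
Proof.
move=> conn.
pose reach k w := [exists t : k.-tuple T, path e v0 t && (last v0 t == w)].
have ex w : exists k, reach k w.
  have /connectP[s ps lw] := conn v0 w; exists (size s).
  by apply/existsP; exists (in_tuple s); rewrite ps -lw /=.
pose dist w := ex_minn (ex w).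
have par w : exists u, w != v0 ->
    [/\ e w u, (dist u < dist w)%N & e v0 w -> u = v0].
  have [->|wv0] := eqVneq w v0; first by exists v0.
  rewrite /dist; case: (ex_minnP (ex w)) => k /existsP[t /andP[pt /eqP lt]] kmin.
  have [ev0w|nev0w] := boolP (e v0 w).
    exists v0 => _; split; rewrite // 1?e_sym //.
    case: ex_minnP => j _ jmin; apply: (@leq_ltn_trans 0%N).
      by apply: jmin; apply/existsP; exists [tuple] => /=.
    case: k t pt lt {kmin} => // t; rewrite tuple0 /= => _ v0w.
    by rewrite v0w eqxx in wv0.
  case: k t pt lt kmin => [|k] t pt lt kmin.
    by move: lt wv0; rewrite tuple0 /= => ->; rewrite eqxx.
  have := size_tuple t; case/lastP E: (val t) => [//|s u]; rewrite size_rcons => -[sk].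
  move: pt lt; rewrite /= E rcons_path last_rcons => /andP[ps els] uw; subst u.
  exists (last v0 s) => _; split => //; first by rewrite e_sym.
  case: ex_minnP => j _ jmin; rewrite ltnS; apply: jmin; apply/existsP.
  by exists (tcast sk (in_tuple s)); rewrite val_tcast /= ps eqxx.
have [p pP] := fin_all_exists par; exists p, dist.
split => w; first by move/pP => [].
  by move/pP => [].
by move=> ev; have /pP[_ _ ->] // : w != v0; rewrite eq_sym edge_neq.
Qed.

End SimpleGraph.

(** * Edge sets listed as ordered pairs along paths *)

Section PairLists.
Variable T : finType.
Implicit Types (l : seq (T * T)) (E : {set T}).

(** Unfolds to the right-hand side of the edge condition in [cycle_with_paths]. *)
Definition undirected l : {set {set T}} := [set [set q.1; q.2] | q : T * T & q \in l].

Lemma undirectedP l E :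
  reflect (exists2 q, q \in l & E = [set q.1; q.2]) (E \in undirected l).
Proof. by apply: (iffP imsetP) => -[q ql ->]; exists q; rewrite ?inE // in ql *. Qed.

Lemma undirected_nil : undirected [::] = set0.
Proof. by apply/setP => E; rewrite inE; apply/undirectedP => -[]. Qed.

Lemma undirected_cons a b l : undirected ((a, b) :: l) = [set a; b] |: undirected l.
Proof.
apply/setP => E; rewrite !inE; apply/undirectedP/idP => [[q]|].
  rewrite inE => /orP[/eqP-> ->|ql ->]; first by rewrite eqxx.
  by apply/orP; right; apply/undirectedP; exists q.
case/orP => [/eqP->|/undirectedP[q ql ->]]; first by exists (a, b); rewrite ?mem_head.
by exists q; rewrite // inE ql orbT.
Qed.

Lemma undirected_cat l1 l2 : undirected (l1 ++ l2) = undirected l1 :|: undirected l2.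
Proof.
elim: l1 => [|[a b] l1 IH] /=; first by rewrite undirected_nil set0U.
by rewrite !undirected_cons IH setUA.
Qed.

Lemma zip_path_cat (x : T) s1 s2 :
  zip (x :: s1 ++ s2) (s1 ++ s2) = zip (x :: s1) s1 ++ zip (last x s1 :: s2) s2.
Proof. by elim: s1 x => [|y s1 IH] x //=; rewrite IH. Qed.

(** The cycle will go out along one branch, cross an edge and come back along another branch
    reversed; this computes the return part. *)
Lemma undirected_rev (x v : T) q :
  undirected (zip (x :: rev (v :: q)) (rev (v :: q)))
    = [set x; last v q] |: undirected (zip (v :: q) q).
Proof.
elim: q v => [|w q IH] v /=; first by rewrite undirected_cons.
rewrite rev_cons -cats1 zip_path_cat undirected_cat IH /= !undirected_cons.
rewrite rev_cons last_rcons undirected_nil setU0 [[set w; v]]setUC -setUA.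
by rewrite [_ :|: [set [set v; w]]]setUC.
Qed.

(** [zip] drops the surplus last vertex on the left, so pairing a cycle with its rotation by one
    amounts to following the closed walk back to its start. *)
Lemma zip_rcons_last (v u : T) s : zip (v :: rcons s u) (rcons s u) = zip (v :: s) (rcons s u).
Proof. by elim: s v => //= w s IH v; rewrite IH. Qed.

Lemma mem_split (U : eqType) (x : U) s : x \in s -> exists s1 s2, s = s1 ++ x :: s2.
Proof. by case/splitPr => s1 s2; exists s1, s2. Qed.

End PairLists.

(** * The tree of parents and the one edge outside it *)

Section Rooted.
Variables (T : finType) (e : rel T) (v0 : T) (p : T -> T) (dist : T -> nat).
Hypothesis e_simple : simple_graph e.
Hypothesis p_edge : forall w, w != v0 -> e w (p w).
Hypothesis p_dist : forall w, w != v0 -> (dist (p w) < dist w)%N.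
Hypothesis p_center : forall w, e v0 w -> p w = v0.
Hypothesis card_edges : #|edges e| = #|T|.

Let e_sym x y : e x y = e y x. Proof. by case: e_simple => s _; rewrite s. Qed.

Lemma parent_center w : w != v0 -> (p w == v0) = e v0 w.
Proof.
move=> wv0; apply/eqP/idP => [pw|/p_center//].
by rewrite e_sym -pw p_edge.
Qed.

Lemma rooted_deg_gt0 w : w != v0 -> (0 < deg e w)%N.
Proof. by move=> /p_edge /deg_gt0. Qed.

Lemma deg_parent_gt1 w : w != v0 -> p w != v0 -> (1 < deg e (p w))%N.
Proof.
move=> wv pv; apply: (@deg_ge2 _ _ _ w (p (p w))); rewrite ?p_edge //.
  by rewrite e_sym p_edge.
by apply/eqP => E; have := p_dist wv; have := p_dist pv; rewrite -E; lia.
Qed.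

(** Excludes the degrees (1, 1) for [charge_edge]: either y is the parent of x and has a parent of
    its own, or x has both its parent and y as neighbours. *)
Lemma no_leaf_edge x y : x != v0 -> y != v0 -> e x y -> (2 < deg e x + deg e y)%N.
Proof.
move=> xv yv exy; have dx := rooted_deg_gt0 xv; have dy := rooted_deg_gt0 yv.
have [pxy|npxy] := eqVneq (p x) y.
  by subst y; have := deg_parent_gt1 xv yv; lia.
by have := deg_ge2 (p_edge xv) exy npxy; lia.
Qed.

Lemma parent_edge_inj :
  {in [set~ v0] &, injective (fun w => [set w; p w])}.
Proof.
move=> w w'; rewrite !inE => wv w'v /set2_inj[[]//|[E E']].
by have := p_dist wv; have := p_dist w'v; rewrite E' E; lia.
Qed.

Definition tree_edges := [set [set w; p w] | w in [set~ v0]].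

Lemma card_tree_edges : #|tree_edges| = #|T|.-1.
Proof. by rewrite card_in_imset ?cardsC1 //; exact: parent_edge_inj. Qed.

Lemma tree_edges_sub : tree_edges \subset edges e.
Proof.
by apply/subsetP => E /imsetP[w]; rewrite !inE => wv ->; rewrite mem_edges // p_edge.
Qed.

(** There are n edges, of which n - 1 join a vertex to its parent. The remaining one avoids v0
    because every neighbour of v0 has v0 as parent. *)
Lemma extra_edge : exists x y,
  [/\ [/\ e x y, x != v0 & y != v0], p x != y, p y != x,
      [set x; y] \notin tree_edges & edges e = [set x; y] |: tree_edges].
Proof.
have c1 : #|edges e :\: tree_edges| = 1%N.
  rewrite cardsD (setIidPr tree_edges_sub) card_edges card_tree_edges.
  have : (0 < #|T|)%N by apply/card_gt0P; exists v0.
  lia.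
have /cards1P[E0 HE] : #|edges e :\: tree_edges| == 1%N by rewrite c1.
have : E0 \in edges e :\: tree_edges by rewrite HE set11.
rewrite inE => /andP[nt /edgesP[x [y [exy E]]]]; subst E0.
have nov0 u w : e u w -> [set u; w] \notin tree_edges -> u != v0.
  move=> euw; apply: contra => /eqP uv; subst u; apply/imsetP; exists w.
    by rewrite !inE eq_sym (edge_neq e_simple euw).
  by rewrite (p_center euw) setUC.
have np u w : e u w -> [set u; w] \notin tree_edges -> p u != w.
  move=> euw nE; apply: contra (nE) => /eqP pu; apply/imsetP; exists u; rewrite ?pu //.
  by rewrite !inE (nov0 _ _ euw).
have eyx : e y x by rewrite e_sym.
have nt' : [set y; x] \notin tree_edges by rewrite setUC.
exists x, y; split; [split=> //|exact: np|exact: np|by []|].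
- exact: nov0 exy nt.
- exact: nov0 eyx nt'.
rewrite -HE; apply/setP => E; rewrite !inE; case: (boolP (E \in tree_edges)) => //=.
  by move=> /(subsetP tree_edges_sub) ->.
by rewrite orbF.
Qed.

(** * The two lower bounds with their equality conditions *)

Section Bounds.
Variables (R : realType) (Delta : nat).
Hypothesis deg_v0 : deg e v0 = Delta.
Hypothesis Delta_ge3 : (3 <= Delta)%N.

Let n : R := #|T|%:R.
Let D : R := Delta%:R.

Lemma sum_except_center (F : T -> R) : \sum_(x | x != v0) F x = \sum_x F x - F v0.
Proof. by rewrite [\sum_x _](bigD1 v0) //= addrC addrK. Qed.

Lemma sum_deg_except_center : \sum_(x | x != v0) (deg e x)%:R = 2 * n - D :> R.
Proof. by rewrite sum_except_center handshake // card_edges deg_v0. Qed.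

Lemma sum_const_except_center (a : R) : \sum_(x | x != v0) a = (n - 1) * a.
Proof. by rewrite sum_except_center sumr_const /n cardT -cardE mulrBl mul1r mulr_natl. Qed.

Definition small_degrees :=
  [forall w, (w != v0) ==> (deg e w <= 2)%N && (e v0 w ==> (deg e w == 2)%N)].

(** The share of the edge xy that goes to x. On an arc into v0 the rebate turns the charge into its
    minimum with √2. *)
Definition arc_charge x y : R :=
  if x == v0 then weight R Delta 2 - Num.sqrt 2
  else charge R (deg e x) - (y == v0)%:R * rebate R (deg e x).

Lemma total_charge :
  D * weight R Delta 2 + Num.sqrt 8 * (n - 2 * D + 2) + Num.sqrt 5 * (D - 2)
    <= \sum_x \sum_(y | e x y) arc_charge x y
    ?= iff [forall (x | x != v0), (deg e x <= 2)%N].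
Proof.
rewrite [X in _ <= X ?= iff _](bigD1 v0) //=.
have -> : \sum_(y | e v0 y) arc_charge v0 y = D * (weight R Delta 2 - Num.sqrt 2).
  by rewrite /arc_charge eqxx sum_neighbors_const deg_v0.
pose L (x : T) : R :=
  2 * Num.sqrt 2 + (3 * Num.sqrt 2 - Num.sqrt 5) * ((deg e x)%:R - 2).
(* The degree sum 2n - D turns the sum of the affine terms [L] into the constants of the bound. *)
have -> : D * weight R Delta 2 + Num.sqrt 8 * (n - 2 * D + 2) + Num.sqrt 5 * (D - 2)
    = D * (weight R Delta 2 - Num.sqrt 2) + \sum_(x | x != v0) L x.
  rewrite /L big_split /= sum_const_except_center -mulr_sumr sumrB.
  by rewrite sum_const_except_center sum_deg_except_center sqrt8; ring.
rewrite (mono_leif (lerD2l _)); apply: leif_sum => x xv.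
have -> : \sum_(y | e x y) arc_charge x y
    = (deg e x)%:R * charge R (deg e x) - (e x v0)%:R * rebate R (deg e x).
  rewrite /arc_charge (negbTE xv) sumrB sum_neighbors_const -mulr_suml.
  congr (_ - _ * _); case: (boolP (e x v0)) => exv.
    rewrite (bigD1 v0) //= eqxx big1 ?addr0 // => y /andP[_ /negbTE->//].
  by rewrite big1 // => y exy; case: eqP => // E; rewrite -E exy in exv.
exact/charge_vertex/rooted_deg_gt0.
Qed.

Lemma sombor_ge_charge :
  (\sum_x \sum_(y | e x y) arc_charge x y) *+ 2 <= sombor e R *+ 2
    ?= iff [forall x, [forall (y | e x y),
       if x == v0 then deg e y == 2%N
       else if y == v0 then deg e x == 2%N
       else (deg e x <= 2)%N && (deg e y <= 2)%N]].
Proof.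
rewrite -sombor_arcs // mulr2n.
(* One of the two copies is summed over reversed arcs, so that each arc sees both shares of its
   edge. *)
have {2}-> : \sum_x \sum_(y | e x y) arc_charge x y
    = \sum_x \sum_(y | e x y) arc_charge y x.
  rewrite (exchange_big_dep xpredT) //=; apply: eq_bigr => x _.
  by apply: eq_bigl => y; rewrite e_sym.
rewrite -big_split /=; apply: leif_sum => x _.
rewrite -big_split /=; apply: leif_sum => y exy.
rewrite /arc_charge.
have xy := edge_neq e_simple exy.
have [xv|xv] := eqVneq x v0.
  subst x; rewrite [y == v0]eq_sym (negbTE xy) ?eqxx mul1r deg_v0.
  by apply: charge_center; rewrite ?rooted_deg_gt0 // eq_sym.
have [yv|yv] := eqVneq y v0.
  subst y; rewrite mul1r deg_v0 [X in X <= _ ?= iff _]addrC [weight _ (deg e x) _]weightC.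
  by apply: charge_center; rewrite ?rooted_deg_gt0.
rewrite !mul0r !subr0; apply: charge_edge; rewrite ?rooted_deg_gt0 //.
exact: no_leaf_edge.
Qed.

Lemma sombor_bound_many :
  D * weight R Delta 2 + Num.sqrt 8 * (n - 2 * D + 2) + Num.sqrt 5 * (D - 2)
    <= sombor e R ?= iff small_degrees.
Proof.
set b := (X in X <= _ ?= iff _).
set s := \sum_x \sum_(y | e x y) arc_charge x y.
have Hs := sombor_ge_charge; rewrite -/s (mono_leif (ler_pMn2r _)) // in Hs.
have [Hle Heq] := leif_trans total_charge Hs; split=> //; rewrite Heq; apply/esym.
apply/forallP/andP => [H|[/forall_inP H1 /forallP H2] w].
  have d2 x : x != v0 -> (deg e x <= 2)%N by move=> xv; case/andP: (implyP (H x) xv).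
  have c2 x : e v0 x -> (deg e x == 2)%N.
    move=> ex; have xv : x != v0 by rewrite eq_sym (edge_neq e_simple ex).
    by case/andP: (implyP (H x) xv) => _ /implyP; apply.
  split; first by apply/forall_inP.
  apply/forallP => x; apply/forall_inP => y exy.
  have [xv|xv] := eqVneq x v0; first by subst x; exact: c2.
  have [yv|yv] := eqVneq y v0; first by subst y; rewrite c2 // e_sym.
  by rewrite !d2.
apply/implyP => wv; rewrite H1 //=; apply/implyP => ew.
by have /forall_inP/(_ w ew) := H2 v0; rewrite eqxx.
Qed.

Definition short_branches :=
  [forall w, (w != v0) ==> (deg e w <= 2)%N && (~~ e v0 w ==> (deg e w == 1)%N)].

Lemma sombor_bound_few :
  (n - D + 1) * weight R Delta 2 + (2 * D - n - 1) * weight R Delta 1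
    + Num.sqrt 5 * (n - D - 1) + Num.sqrt 8
    <= sombor e R ?= iff short_branches.
Proof.
have [x [y [[exy xv yv] px py nt edgesE]]] := extra_edge.
have -> : sombor e R = weight R (deg e x) (deg e y)
    + \sum_(w | w != v0) weight R (deg e w) (deg e (p w)).
  rewrite /sombor edgesE big_setU1 //= sqrt_sum_edge //; congr (_ + _).
  rewrite big_imset /=; last exact: parent_edge_inj.
  apply: eq_big => w; rewrite !inE // => wv.
  by rewrite sqrt_sum_edge // p_edge.
have dx : (1 < deg e x)%N := deg_ge2 (p_edge xv) exy px.
have dy : (1 < deg e y)%N.
  by apply: (deg_ge2 (p_edge yv) _ py); rewrite e_sym.
pose t := weight R Delta 2 - weight R Delta 1.
have t_bounds : 0 < t < 1 / 2 by exact: weight_step.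
pose F w : R := (if e v0 w then weight R Delta 1 else Num.sqrt 5)
                 + t * ((deg e w)%:R - 1).
have -> : (n - D + 1) * weight R Delta 2 + (2 * D - n - 1) * weight R Delta 1
    + Num.sqrt 5 * (n - D - 1) + Num.sqrt 8
    = Num.sqrt 8 + \sum_(w | w != v0) F w.
  rewrite /F big_split /= -mulr_sumr sumrB.
  rewrite sum_const_except_center sum_deg_except_center.
  have -> : \sum_(w | w != v0) (if e v0 w then weight R Delta 1 else Num.sqrt 5)
     = D * weight R Delta 1 + (n - 1 - D) * Num.sqrt 5.
    (* Count √5 at every vertex and correct it at the [Delta] neighbours of v0. *)
    transitivity (\sum_(w | w != v0) ((if e v0 w then weight R Delta 1 - Num.sqrt 5 else 0)
        + Num.sqrt 5)).
      by apply: eq_bigr => w _; case: ifP => _; rewrite ?subrK ?add0r.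
    rewrite big_split /= sum_const_except_center -big_mkcondr /=.
    have -> : \sum_(w | (w != v0) && e v0 w) (weight R Delta 1 - Num.sqrt 5)
       = D * (weight R Delta 1 - Num.sqrt 5).
      rewrite /D -deg_v0 -sum_neighbors_const; apply: eq_bigl => w.
      by case ew : (e v0 w); rewrite ?andbF // eq_sym (edge_neq e_simple).
    by ring.
  by rewrite /t; ring.
have Hx : Num.sqrt 8 <= weight R (deg e x) (deg e y)
    ?= iff ((deg e x == 2) && (deg e y == 2))%N.
  have := weight_ge2 R dx dy; by [].
have Hw : \sum_(w | w != v0) F w <= \sum_(w | w != v0) weight R (deg e w) (deg e (p w))
    ?= iff [forall (w | w != v0), if e v0 w then (deg e w <= 2)%N
            else (deg e w == 1)%N && (deg e (p w) == 2)%N].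
  apply: leif_sum => w wv; rewrite /F.
  have dw := rooted_deg_gt0 wv.
  case: ifP => ew.
    by rewrite (p_center ew) deg_v0 [weight _ (deg e w) _]weightC; exact: weight_convex.
  by apply: weight_far => //; apply: deg_parent_gt1; rewrite ?parent_center ?ew.
have [Hle Heq] := leifD Hx Hw; split=> //; rewrite Heq; apply/esym.
apply/forallP/andP => [H|[_ /forall_inP H] w].
  have d2 u : u != v0 -> (deg e u <= 2)%N by move=> uv; case/andP: (implyP (H u) uv).
  have d1 u : u != v0 -> ~~ e v0 u -> (deg e u == 1)%N.
    by move=> uv; case/andP: (implyP (H u) uv) => _ /implyP.
  split; first by rewrite !eqn_leq dx dy !d2.
  apply/forall_inP => w wv; case: ifP => ew; first exact: d2.
  have pv : p w != v0 by rewrite parent_center ?ew.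
  by rewrite d1 ?ew // eqn_leq d2 // deg_parent_gt1.
apply/implyP => wv; have := H w wv; case: ifP => ew; first by move->.
by case/andP => /eqP-> _.
Qed.

End Bounds.

(** * Structure when all degrees off the root are at most 2 *)

Section Spider.
Hypothesis deg_le2 : forall w, w != v0 -> (deg e w <= 2)%N.

Let down : rel T := fun a b => a == p b.

(** A partial tree of parents, with one descending chain for each neighbour of v0. All neighbours of
    v0 are present from the start, so growth only lengthens chains. *)
Let spider ps :=
  [/\ size ps = deg e v0, all (fun q => 0 < size q)%N ps, all (path down v0) ps,
      uniq (v0 :: flatten ps) & forall w, e v0 w -> w \in flatten ps].

Lemma zip_down x q : path down x q -> zip (x :: q) q = [seq (p b, b) | b <- q].
Proof. by elim: q x => [|y q IH] x //= /andP[/eqP <- /IH <-]. Qed.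

(* A vertex other than the root has at most one child, so a branch can only grow at its end. *)
Lemma no_inner_edge (x y : T) q1 q2 : x != v0 -> uniq (v0 :: q1 ++ x :: q2) ->
  path down v0 (q1 ++ x :: q2) -> e x y -> p x != y -> ohead q2 != Some y -> q2 = [::].
Proof.
case: q2 => [//|z q2] xv U; rewrite cat_path /= => /and4P[_ _ /eqP xz _] exy pxy zy.
have zv : z != v0.
  move: U; rewrite /= mem_cat !inE !negb_or => /andP[/and4P[_ _ zv _] _].
  by rewrite eq_sym.
have exz : e x z by rewrite xz e_sym p_edge.
suff : (deg e x <= 2)%N = false by rewrite deg_le2.
apply: (deg_le2P (p_edge xv) exy exz); rewrite /= !inE negb_or pxy andbT /=.
apply/andP; split; last by apply: contra zy => /eqP->.
by apply/eqP => E; have := p_dist xv; have := p_dist zv; rewrite E -xz; lia.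
Qed.

Lemma spider_init : exists ps, spider ps.
Proof.
pose nb := enum [set w | e v0 w].
exists [seq [:: w] | w <- nb].
have fE : flatten [seq [:: w] | w <- nb] = nb by elim: nb => //= w s ->.
split.
- by rewrite size_map -cardE.
- by rewrite all_map; apply/allP.
- rewrite all_map; apply/allP => w /=; rewrite mem_enum inE => /p_center <-.
  by rewrite /down eqxx.
- rewrite fE /= enum_uniq andbT mem_enum inE.
  by apply/negP => /(edge_neq e_simple); rewrite eqxx.
by move=> w ew; rewrite fE mem_enum inE.
Qed.

(** The parent of y is not v0, whose neighbours are all present; having degree at most 2, it must be
    the end of its branch, and y is appended there. *)
Lemma spider_step ps y : spider ps -> y != v0 -> y \notin flatten ps ->
  p y \in v0 :: flatten ps -> exists ps', spider ps' /\ perm_eq (flatten ps') (y :: flatten ps).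
Proof.
case=> sz ne pa un nb yv ny.
rewrite inE parent_center // => /orP[/nb|/flattenP[q qps pyq]].
  by rewrite (negbTE ny).
have [ps1 [ps2 psE]] := mem_split qps; have [q1 [q2 qE]] := mem_split pyq.
have perm_ps : perm_eq (flatten ps) (q ++ flatten (ps1 ++ ps2)).
  by rewrite psE !flatten_cat /= perm_catCA.
have fl x : x \in q -> x \in flatten ps by rewrite (perm_mem perm_ps) mem_cat => ->.
have pyv : p y != v0.
  apply: contraTneq un => E; rewrite /= negb_and negbK -{1}E.
  by rewrite (fl _ pyq).
have Uq : uniq (v0 :: q).
  move: (un); rewrite cons_uniq (perm_uniq perm_ps) cat_uniq => /and4P[v0f uq _ _].
  by rewrite /= uq andbT; apply: contra v0f => /fl.
have pq : path down v0 q by move/allP: pa; apply.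
have ey : e (p y) y by rewrite e_sym p_edge.
have q2E : q2 = [::].
  rewrite qE in pq Uq; apply: (no_inner_edge pyv Uq pq ey).
    by apply/eqP => E; have := p_dist yv; have := p_dist pyv; rewrite E; lia.
  case: q2 qE {Uq pq} => [//|z q2] qE; apply/eqP => -[E].
  by move/negP: ny; apply; apply: fl; rewrite qE E mem_cat !inE eqxx !orbT.
exists (ps1 ++ rcons q y :: ps2).
have perm_new : perm_eq (flatten (ps1 ++ rcons q y :: ps2)) (y :: flatten ps).
  rewrite psE !flatten_cat /= perm_sym -cat1s perm_catCA perm_cat2l -cats1 -catA.
  by rewrite perm_catCA.
split=> //; split.
- by rewrite -sz psE !size_cat.
- move: ne; rewrite psE !all_cat /= size_rcons => /and3P[-> _ ->//].
- move: pa; rewrite psE !all_cat /= rcons_path => /and3P[-> -> ->].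
  by rewrite qE q2E last_cat /= /down eqxx.
- rewrite /= (perm_uniq perm_new) (perm_mem perm_new) inE negb_or eq_sym yv /= ny.
  by move: un; rewrite cons_uniq => /andP[-> ->].
by move=> w /nb; rewrite (perm_mem perm_new) inE => ->; rewrite orbT.
Qed.

Lemma spanning_spider : exists ps, spider ps /\ forall x, x \in v0 :: flatten ps.
Proof.
have [ps sp] := spider_init.
have [k] := ubnP (#|T| - size (flatten ps))%N.
elim: k ps sp => // k IH ps sp; rewrite ltnS => lek.
have [/forallP cov|/forallPn[y0 ny0]] := boolP [forall x, x \in v0 :: flatten ps].
  by exists ps.
(* A missing vertex of least [dist] has its parent, which is nearer to v0, already in the bundle. *)
case: (@arg_minnP _ y0 [pred z | z \notin v0 :: flatten ps] dist ny0) => y ny ymin.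
have yv : y != v0 by apply: contra ny => /eqP->; rewrite mem_head.
have py : p y \in v0 :: flatten ps.
  by apply/negPn/negP => /ymin; have := p_dist yv; lia.
have nyf : y \notin flatten ps by apply: contra ny; rewrite inE => ->; rewrite orbT.
have [ps' [sp' pm]] := spider_step sp yv nyf py.
apply: (IH ps' sp'); rewrite (perm_size pm) /=.
have := uniq_leq_size (s1 := y :: flatten ps) (s2 := enum T).
rewrite -cardE /= nyf => /(_ _ _)/= H.
have : (size (flatten ps) < #|T|)%N.
  apply: H; first by case: sp => _ _ _; rewrite cons_uniq => /andP[].
  by move=> z _; rewrite mem_enum.
by move=> lt; rewrite subnS prednK // subn_gt0.
Qed.

(** Each end of the extra edge has its parent and the other end as neighbours, hence no child, and
    so ends a branch. These two branches form the cycle; the others are the attached paths. *)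
Lemma spider_cycle : exists c' ps,
  [/\ [/\ (2 <= size c')%N, size ps = (deg e v0 - 2)%N & all (fun q => 0 < size q)%N ps],
      uniq ((v0 :: c') ++ flatten ps), (forall x, x \in (v0 :: c') ++ flatten ps)
    & edges e = undirected (zip (v0 :: c') (rot 1 (v0 :: c'))
                            ++ flatten [seq zip (v0 :: q) q | q <- ps])].
Proof.
have [x [y [[exy xv yv] px py nt edgesE]]] := extra_edge.
have [ps [[sz ne pa un nb] cov]] := spanning_spider.
have eyx : e y x by rewrite e_sym.
have branch a b : a != v0 -> e a b -> p a != b -> p b != a ->
    exists2 q, q \in ps & a \in q /\ last v0 q = a.
  move=> av eab pab pba.
  have := cov a; rewrite inE (negbTE av) /= => /flattenP[q qps aq]; exists q => //.
  split=> //.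
  have [q1 [q2 qE]] := mem_split aq.
  have Uq : uniq (v0 :: q).
    have [ps1 [ps2 psE]] := mem_split qps.
    move: un; rewrite psE flatten_cat /= !mem_cat !cat_uniq !negb_or.
    by case/andP => /and3P[_ -> _] /and3P[_ _ /and3P[]].
  have pq : path down v0 q by move/allP: pa; apply.
  rewrite qE in Uq pq *; rewrite (no_inner_edge av Uq pq eab pab) ?last_cat //.
  case: q2 qE Uq pq => [//|z q2] _ _; rewrite cat_path /= => /and4P[_ _ /eqP pz _].
  by apply: contra pba => /eqP[<-]; rewrite pz.
have [q1 q1ps [xq1 lq1]] := branch x y xv exy px py.
have [q2 q2ps [yq2 lq2]] := branch y x yv eyx py px.
have q12 : q1 != q2.
  by apply: contraTneq (edge_neq e_simple exy) => E; rewrite -lq1 -lq2 E eqxx.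
pose ps' := rem q2 (rem q1 ps).
have q2r : q2 \in rem q1 ps.
  by move: q2ps; rewrite (perm_mem (perm_to_rem q1ps)) inE eq_sym (negbTE q12).
have pps : perm_eq ps (q1 :: q2 :: ps').
  by rewrite (permPl (perm_to_rem q1ps)) perm_cons perm_to_rem.
have cE : perm_eq ((v0 :: q1 ++ rev q2) ++ flatten ps') (v0 :: flatten ps).
  rewrite /= perm_cons perm_sym (permPl (perm_flatten pps)) /= -catA perm_cat2l.
  by rewrite perm_cat2r perm_sym perm_rev.
exists (q1 ++ rev q2), ps'; split.
- split; last by move: ne; rewrite (perm_all _ pps) /= => /and3P[].
    move/allP: ne => ne; rewrite size_cat size_rev.
    exact: (leq_add (ne _ q1ps) (ne _ q2ps)).
  by rewrite -sz (perm_size pps) /= subn2.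
- by rewrite (perm_uniq cE).
- by move=> z; rewrite (perm_mem cE).
have down_q q : q \in ps -> zip (v0 :: q) q = [seq (p b, b) | b <- q].
  by move=> qps; apply: zip_down; move/allP: pa; apply.
(* The closed walk follows [q1] to x, crosses to y and returns to v0 along [q2] reversed. *)
rewrite rot1_cons -zip_rcons_last rcons_cat -rev_cons zip_path_cat undirected_cat.
rewrite undirected_cat undirected_rev lq1 lq2.
have -> : flatten [seq zip (v0 :: q) q | q <- ps'] = [seq (p b, b) | b <- flatten ps'].
  rewrite map_flatten; congr flatten; apply/eq_in_map => q /mem_rem/mem_rem; exact: down_q.
rewrite !down_q // [undirected _ :|: (_ |: _)]setUCA -setUA -!undirected_cat -!map_cat.
rewrite edgesE; congr (_ |: _); apply/setP => E.
have perm_f : perm_eq (flatten ps) ((q1 ++ q2) ++ flatten ps').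
  by rewrite (permPl (perm_flatten pps)) /= catA.
apply/imsetP/undirectedP => [[w]|[_ /mapP[w wf ->] ->]].
  rewrite !inE => wv ->; exists (p w, w); last by rewrite setUC.
  by apply: map_f; rewrite -(perm_mem perm_f); have := cov w; rewrite inE (negbTE wv).
exists w; last by rewrite setUC.
rewrite -(perm_mem perm_f) in wf; rewrite !inE.
by apply: contraTneq un => wv; rewrite /= -wv wf.
Qed.

End Spider.
End Rooted.

(** * Degrees in a cycle with attached paths *)

Section CycleWithPaths.
Variables (T : finType) (e : rel T) (v0 : T) (c' : seq T) (ps : seq (seq T)).
Hypothesis e_simple : simple_graph e.

Let arcs := zip (v0 :: c') (rot 1 (v0 :: c')) ++ flatten [seq zip (v0 :: q) q | q <- ps].

Hypothesis verts_uniq : uniq ((v0 :: c') ++ flatten ps).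
Hypothesis verts_cover : forall x, x \in (v0 :: c') ++ flatten ps.
Hypothesis edgesE : edges e = undirected arcs.

Let e_sym x y : e x y = e y x. Proof. by case: e_simple => s _; rewrite s. Qed.

Lemma arc_edge x y : (x, y) \in arcs -> e x y.
Proof.
by move=> xy; rewrite -mem_edges // edgesE; apply/undirectedP; exists (x, y).
Qed.

Lemma edge_arc x y : e x y -> ((x, y) \in arcs) || ((y, x) \in arcs).
Proof.
rewrite -mem_edges // edgesE => /undirectedP[[a b] ab] /set2_inj[[-> ->]|[-> ->]];
  by rewrite ab ?orbT.
Qed.

Lemma deg_le_count w :
  (deg e w <= count_mem w (unzip1 arcs) + count_mem w (unzip2 arcs))%N.
Proof.
rewrite !count_map -!size_filter.
pose s := [seq q.2 | q <- arcs & q.1 == w] ++ [seq q.1 | q <- arcs & q.2 == w].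
apply: leq_trans (_ : size s <= _)%N; last by rewrite size_cat !size_map.
apply: leq_trans (card_size s); apply/subset_leq_card/subsetP => y; rewrite inE.
move=> /edge_arc ewy; rewrite mem_cat; case/orP: ewy => ewy; apply/orP; [left|right].
  by apply/mapP; exists (w, y); rewrite // mem_filter /= eqxx.
by apply/mapP; exists (y, w); rewrite // mem_filter /= eqxx.
Qed.

Lemma unzip1_arcs : unzip1 arcs = (v0 :: c') ++ flatten [seq belast v0 q | q <- ps].
Proof.
rewrite /unzip1 map_cat; congr (_ ++ _); first by apply: unzip1_zip; rewrite size_rot.
rewrite map_flatten -map_comp; congr flatten; apply: eq_map => q /=.
by elim: q v0 => [|y q IH] x //=; rewrite IH.
Qed.

Lemma unzip2_arcs : unzip2 arcs = rot 1 (v0 :: c') ++ flatten ps.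
Proof.
rewrite /unzip2 map_cat; congr (_ ++ _); first by apply: unzip2_zip; rewrite size_rot.
rewrite map_flatten -map_comp -[in RHS](map_id ps); congr flatten; apply: eq_map => q /=.
exact: unzip2_zip.
Qed.

Lemma count_verts w : count_mem w ((v0 :: c') ++ flatten ps) = 1%N.
Proof. by rewrite count_uniq_mem // verts_cover. Qed.

(** Every vertex is entered by exactly one arc; v0 is entered by the arc closing the cycle. *)
Lemma count_unzip2 w : count_mem w (unzip2 arcs) = 1%N.
Proof.
rewrite unzip2_arcs -[RHS](count_verts w) [LHS]count_cat [RHS]count_cat; congr (_ + _)%N.
by apply: (elimT permP); rewrite perm_rot.
Qed.

Lemma count_belast (w : T) q : w != v0 ->
  (count_mem w (belast v0 q) + (last v0 q == w) = count_mem w q)%N.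
Proof.
move=> wv; have : count_mem w (v0 :: q) = count_mem w (rcons (belast v0 q) (last v0 q)).
  by rewrite -lastI.
by rewrite -cats1 count_cat /= eq_sym (negbTE wv) !addn0 add0n => ->.
Qed.

Lemma count_flatten_belast (w : T) (qs : seq (seq T)) : w != v0 ->
  (count_mem w (flatten [seq belast v0 q | q <- qs]) <= count_mem w (flatten qs))%N.
Proof.
move=> wv; elim: qs => //= q qs IH; rewrite !count_cat; apply: leq_add => //.
by rewrite -(count_belast q wv) leq_addr.
Qed.

(** Off v0, a vertex is entered once and left at most once. *)
Lemma branch_deg_le2 w : w != v0 -> (deg e w <= 2)%N.
Proof.
move=> wv; apply: leq_trans (deg_le_count w) _; rewrite count_unzip2 addn1 ltnS.
rewrite -(count_verts w) unzip1_arcs !count_cat leq_add2l.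
exact: count_flatten_belast.
Qed.

(** The end of a path is entered once and never left. *)
Lemma branch_end_deg_le1 q : q \in ps -> (0 < size q)%N -> (deg e (last v0 q) <= 1)%N.
Proof.
move=> qps q0; set w := last v0 q.
have wq : w \in q by rewrite /w; case: q q0 {qps w} => //= x q _; rewrite mem_last.
have wv : w != v0.
  apply: contraTneq verts_uniq => E; rewrite /= negb_and negbK mem_cat; apply/orP; left.
  by apply/orP; right; apply/flattenP; exists q; rewrite // -E.
apply: leq_trans (deg_le_count w) _; rewrite count_unzip2 addn1.
rewrite -(count_verts w) unzip1_arcs !count_cat ltn_add2l.
have [ps1 [ps2 ->]] := mem_split qps.
rewrite map_cat !flatten_cat /= !count_cat -(count_belast q wv) eqxx.
rewrite -addnS; apply: leq_add; first exact: count_flatten_belast.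
by rewrite addn1 addSn ltnS leq_add2l count_flatten_belast.
Qed.

(** If [s1] is empty, the default v0 of [last] is the true predecessor of b. *)
Lemma cycle_edge s1 b s2 : c' = s1 ++ b :: s2 -> e (last v0 s1) b.
Proof.
move=> cE; apply: arc_edge; rewrite mem_cat rot1_cons -zip_rcons_last cE rcons_cat.
by rewrite zip_path_cat mem_cat /= mem_head orbT.
Qed.

Lemma cycle_close : e (last v0 c') v0.
Proof.
apply: arc_edge; rewrite mem_cat rot1_cons -zip_rcons_last -cats1.
by rewrite zip_path_cat mem_cat /= mem_head orbT.
Qed.

Lemma path_edge q s1 b s2 : q \in ps -> q = s1 ++ b :: s2 -> e (last v0 s1) b.
Proof.
move=> qps qE; apply: arc_edge; rewrite mem_cat; apply/orP; right.
apply/flattenP; exists (zip (v0 :: q) q); first by apply/mapP; exists q.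
by rewrite qE zip_path_cat mem_cat /= mem_head orbT.
Qed.

Lemma path_uniq q : q \in ps -> uniq (v0 :: q).
Proof.
move=> qps; have [ps1 [ps2 psE]] := mem_split qps.
move: verts_uniq; rewrite psE cat_cons cons_uniq flatten_cat /= !mem_cat !cat_uniq !negb_or.
by case/andP => /and4P[_ _ -> _] /and3P[_ _ /and3P[_ _ /and3P[]]].
Qed.

Lemma cycle_uniq : uniq (v0 :: c').
Proof. by move: verts_uniq; rewrite cat_uniq => /and3P[]. Qed.

Lemma cover_cases w : w != v0 -> w \in c' \/ exists2 q, q \in ps & w \in q.
Proof.
move=> wv; have := verts_cover w; rewrite mem_cat inE (negbTE wv) /=.
by case/orP => [|/flattenP]; [left|right].
Qed.

(** Identifies the head of any given decomposition with a previously chosen vertex of degree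
    [Delta]. *)
Lemma center_unique x : (3 <= deg e x)%N -> x = v0.
Proof.
move=> dx; apply/eqP/negPn/negP => /branch_deg_le2; by rewrite leqNgt dx.
Qed.

Lemma last_notin (s1 s2 : seq T) (b z : T) :
  uniq (v0 :: s1 ++ b :: s2) -> z \in s2 -> last v0 s1 != z.
Proof.
move=> U zs; apply: contraTneq U => E.
rewrite -cat_cons lastI -cats1 -catA cat_uniq E /=.
by rewrite !inE zs !orbT /= !andbF.
Qed.

Lemma cycle_deg_gt1 w : (2 <= size c')%N -> w \in c' -> (1 < deg e w)%N.
Proof.
move=> sz wc; have [s1 [s2 cE]] := mem_split wc.
have e1 := cycle_edge cE; rewrite e_sym in e1; have U := cycle_uniq.
case: s2 cE => [|z s2] cE.
  have e2 : e w v0 by have := cycle_close; rewrite cE last_cat.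
  apply: (deg_ge2 e1 e2).
  (* The last vertex of the cycle is adjacent to its predecessor and to v0, which differ because
     [c'] has at least two vertices. *)
  case/lastP: s1 cE {e1} => [|s1 z] cE; first by rewrite cE in sz.
  rewrite last_rcons; apply: contraTneq U => E.
  by rewrite cE E /= mem_cat mem_rcons mem_head.
have e2 : e w z.
  by have := @cycle_edge (rcons s1 w) z s2; rewrite last_rcons cat_rcons; apply.
apply: (deg_ge2 e1 e2).
by rewrite cE in U; apply: last_notin U _; rewrite mem_head.
Qed.

Lemma path_deg_gt1 q s1 w z s2 : q \in ps -> q = s1 ++ w :: z :: s2 -> (1 < deg e w)%N.
Proof.
move=> qps qE; have U := path_uniq qps; have e1 := path_edge qps qE; rewrite e_sym in e1.
have e2 : e w z.
  have := @path_edge q (rcons s1 w) z s2 qps; rewrite last_rcons cat_rcons; exact.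
apply: (deg_ge2 e1 e2).
by rewrite qE in U; apply: last_notin U _; rewrite mem_head.
Qed.

Lemma long_paths_deg w : (2 <= size c')%N -> all (fun q => 2 <= size q)%N ps ->
  e v0 w -> (deg e w == 2)%N.
Proof.
move=> sz /allP psz ew; have wv : w != v0 by rewrite eq_sym (edge_neq e_simple ew).
rewrite eqn_leq branch_deg_le2 //=.
have [|[q qps wq]] := cover_cases wv; first exact: cycle_deg_gt1.
have [s1 [[|z s2] qE]] := mem_split wq; last exact: path_deg_gt1 qE.
have := psz _ qps; rewrite qE; case/lastP: s1 qE => [//|s1 z] qE _.
have ewv : e w v0 by rewrite e_sym.
have ewz : e w z by rewrite e_sym; have := path_edge qps qE; rewrite last_rcons.
apply: (deg_ge2 ewv ewz); apply: contraTneq (path_uniq qps) => ->.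
by rewrite qE /= mem_cat mem_rcons mem_head.
Qed.

(** The other two vertices of the triangle and the first vertex of each path are adjacent to v0,
    which leaves only the ends of two-edge paths. *)
Lemma short_paths_deg w : size c' = 2%N ->
  all (fun q => (size q == 1) || (size q == 2))%N ps ->
  w != v0 -> ~~ e v0 w -> (deg e w <= 1)%N.
Proof.
move=> sz /allP psz wv new.
have [|[q qps wq]] := cover_cases wv.
  case cE : c' sz => [|a [|b []]] // _; rewrite !inE => /orP[] /eqP E; subst w.
    by have := @cycle_edge [::] a [:: b] cE; rewrite (negbTE new).
  by have := cycle_close; rewrite cE /= e_sym (negbTE new).
case: q qps wq (psz q qps) => [//|a [|b []]] // qps; rewrite !inE.
  by move=> /eqP E; subst w; have := @path_edge _ [::] a [::] qps erefl; rewrite (negbTE new).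
case/orP => /eqP E _; subst w; last exact: (branch_end_deg_le1 qps).
by have := @path_edge _ [::] a [:: b] qps erefl; rewrite (negbTE new).
Qed.

(** A path with a single edge would give v0 a neighbour of degree at most 1. *)
Lemma long_pathsP : all (fun q => 0 < size q)%N ps ->
  (forall w, e v0 w -> deg e w = 2%N) -> all (fun q => 2 <= size q)%N ps.
Proof.
move=> /allP ne d2; apply/allP => -[|w [|z q]] // qps; first by have := ne _ qps.
have := branch_end_deg_le1 qps isT.
by rewrite /= d2 //; exact: (@path_edge _ [::] w [::] qps).
Qed.

(** Having two neighbours, b must be adjacent to v0, which is then a third one, against the degree
    bound 2. *)
Lemma inner_vertex_false a b d : (forall w, w != v0 -> ~~ e v0 w -> deg e w = 1%N) ->
  uniq [:: v0; a; b; d] -> e a b -> e b d -> False.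
Proof.
move=> d1; rewrite /= !inE !negb_or -!andbA andbT => /and3P[va vb /and4P[vd ab ad bd]].
rewrite e_sym => eba ebd.
have bv : b != v0 by rewrite eq_sym.
have [evb|/(d1 b bv) db] := boolP (e v0 b); last first.
  by have := deg_ge2 eba ebd ad; rewrite db.
have ebv : e b v0 by rewrite e_sym.
have := branch_deg_le2 bv.
by rewrite (deg_le2P eba ebd ebv) //= !inE negb_or ad ![_ == v0]eq_sym va vd.
Qed.

(** A cycle of length at least 4, or a path with at least 3 edges, contains three consecutive
    vertices off v0. *)
Lemma short_pathsP : all (fun q => 0 < size q)%N ps -> (2 <= size c')%N ->
  (forall w, w != v0 -> ~~ e v0 w -> deg e w = 1%N) ->
  size c' = 2%N /\ all (fun q => (size q == 1) || (size q == 2))%N ps.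
Proof.
move=> /allP ne sz d1; split.
  case cE : c' sz => [|a [|b [|d s]]] // _; have U := cycle_uniq; exfalso.
  apply: (@inner_vertex_false a b d d1).
  - apply: subseq_uniq U; rewrite cE; exact: (prefix_subseq [:: v0; a; b; d] s).
  - exact: (@cycle_edge [:: a] b (d :: s) cE).
  exact: (@cycle_edge [:: a; b] d s cE).
apply/allP => -[|a [|b [|d s]]] // qps; first by have := ne _ qps.
exfalso; have U := path_uniq qps; apply: (@inner_vertex_false a b d d1).
- by apply: subseq_uniq U; exact: (prefix_subseq [:: v0; a; b; d] s).
- exact: (@path_edge _ [:: a] b (d :: s) qps).
exact: (@path_edge _ [:: a; b] d s qps).
Qed.

Lemma card_verts : #|T| = (size c' + size (flatten ps)).+1.
Proof.
rewrite -addSn -[(size c').+1]/(size (v0 :: c')) -size_cat -(card_uniqP verts_uniq).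
by apply: eq_card => x; rewrite verts_cover.
Qed.

End CycleWithPaths.

(** * From the degree conditions to the extremal graphs *)

Lemma count_size12 (T : Type) (qs : seq (seq T)) :
  all (fun q => (size q == 1) || (size q == 2))%N qs ->
  let k1 := count (fun q => size q == 1)%N qs in
  let k2 := count (fun q => size q == 2)%N qs in
  size qs = (k1 + k2)%N /\ size (flatten qs) = (k1 + 2 * k2)%N.
Proof.
elim: qs => //= q qs IH /andP[q12 /IH[-> sf]]; rewrite size_cat sf.
by case/orP: q12 => /eqP->; split; lia.
Qed.

Theorem theorem1p2 (R : realType) (T : finType) (e : rel T) (n Delta : nat) :
  simple_graph e -> #|T| = n -> (5 <= n)%N ->
  (3 <= Delta)%N -> (Delta <= n - 2)%N ->
  unicyclic e -> maxdeg e = Delta ->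
  ((Delta <= (n + 1) %/ 2)%N ->
     let b : R := Delta%:R * Num.sqrt (Delta%:R ^+ 2 + 4)
                  + Num.sqrt 8 * (n%:R - 2 * Delta%:R + 2)
                  + Num.sqrt 5 * (Delta%:R - 2) in
     b <= sombor e R /\ (sombor e R = b <-> is_U_Delta e Delta)) /\
  (((n + 1) %/ 2 < Delta)%N ->
     let b : R := (n%:R - Delta%:R + 1) * Num.sqrt (Delta%:R ^+ 2 + 4)
                  + (2 * Delta%:R - n%:R - 1) * Num.sqrt (Delta%:R ^+ 2 + 1)
                  + Num.sqrt 5 * (n%:R - Delta%:R - 1) + Num.sqrt 8 in
     b <= sombor e R /\ (sombor e R = b <-> is_U_n_Delta e n Delta)).
Proof.
move=> e_simple cardT n5 D3 Dn [conn cardE] maxD.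
have [v0 deg_v0] : exists v0, deg e v0 = Delta.
  have T0 : (0 < #|T|)%N by rewrite cardT; apply: leq_trans n5.
  by have [v0 Hv0] := bigop.eq_bigmax (deg e) T0; exists v0; rewrite -maxD -Hv0.
have [p [dist [p_edge p_dist p_center]]] := bfs_parent e_simple v0 conn.
have deg0 w : w != v0 -> (0 < deg e w)%N := rooted_deg_gt0 p_edge (w := w).
have center c ps : cycle_with_paths e c ps -> exists c', [/\ c = v0 :: c',
    uniq ((v0 :: c') ++ flatten ps), (forall x : T, x \in (v0 :: c') ++ flatten ps)
    & edges e = undirected (zip (v0 :: c') (rot 1 (v0 :: c'))
                            ++ flatten [seq zip (v0 :: q) q | q <- ps])].
  case=> v [c' [-> [U [cov E]]]].
  have -> : v0 = v by apply: (center_unique e_simple U cov E); rewrite deg_v0.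
  by exists c'.
have w1 : Num.sqrt (Delta%:R ^+ 2 + 1) = weight R Delta 1 by rewrite /weight expr1n.
have w2 : Num.sqrt (Delta%:R ^+ 2 + 4) = weight R Delta 2.
  by rewrite /weight; congr Num.sqrt; ring.
split=> Dhalf /=.
  have [le_b eq_b] := sombor_bound_many e_simple p_edge p_dist cardE R deg_v0 D3.
  rewrite w2 -cardT; split=> //.
  rewrite (rwP eqP) eq_sym eq_b; split.
    move=> /forallP small.
    have d2 w : w != v0 -> (deg e w <= 2)%N.
      by move=> wv; have /implyP/(_ wv)/andP[] := small w.
    have dN w : e v0 w -> deg e w = 2%N.
      move=> ew; have wv : w != v0 by rewrite eq_sym (edge_neq e_simple ew).
      by have /implyP/(_ wv)/andP[_ /implyP/(_ ew)/eqP] := small w.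
    have [c' [ps [[sc sps ne] U cov E]]] :=
      spider_cycle e_simple p_edge p_dist p_center cardE d2.
    exists (v0 :: c'), ps; rewrite sps deg_v0; split=> //; split=> //; split.
      exact: (long_pathsP e_simple U cov E ne dN).
    by exists v0, c'.
  case=> c [ps [sc [sps [ne /center [c' [cE U cov E]]]]]].
  apply/forallP => w; apply/implyP => wv.
  rewrite (branch_deg_le2 e_simple U cov E wv) /=; apply/implyP => ew.
  by apply: (long_paths_deg e_simple U cov E _ ne ew); rewrite cE in sc.
have [le_b eq_b] := sombor_bound_few e_simple p_edge p_dist p_center cardE R deg_v0 D3.
rewrite w1 w2 -cardT; split=> //.
rewrite (rwP eqP) eq_sym eq_b; split.
  move=> /forallP short.
  have d2 w : w != v0 -> (deg e w <= 2)%N.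
    by move=> wv; have /implyP/(_ wv)/andP[] := short w.
  have d1 w : w != v0 -> ~~ e v0 w -> deg e w = 1%N.
    by move=> wv ew; have /implyP/(_ wv)/andP[_ /implyP/(_ ew)/eqP] := short w.
  have [c' [ps [[sc sps ne] U cov E]]] :=
    spider_cycle e_simple p_edge p_dist p_center cardE d2.
  have [sc2 sps12] := short_pathsP e_simple U cov E ne sc d1.
  have [k12 kf] := count_size12 sps12.
  (* With k1 paths of one edge and k2 of two, k1 + k2 = Delta - 2 and n = 3 + k1 + 2 k2, which
     determines both numbers. *)
  have := card_verts U cov; rewrite cardT sc2 kf => nE.
  rewrite deg_v0 k12 in sps.
  exists (v0 :: c'), ps; split; first by rewrite /= sc2.
  split=> //; split; first by lia.
  split; first by lia.
  by exists v0, c'.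
case=> c [ps [sc [sps [_ [_ /center [c' [cE U cov E]]]]]]].
rewrite cE in sc; case: sc => sc.
apply/forallP => w; apply/implyP => wv.
rewrite (branch_deg_le2 e_simple U cov E wv) /=; apply/implyP => ew.
by rewrite eqn_leq deg0 // (short_paths_deg e_simple U cov E sc sps wv ew).
Qed.
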